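(* If $G$ and $H$ are graphs, then $$d(G \Box H) \leq \min \{ |V(G)| \cdot d(H),\ |V(H)| \cdot d(G) \},$$ where $G \Box H$ denotes the Cartesian product of $G$ and $H$.
   Context: Graphs are finite and simple. The deduction game on a graph $G$: a layout is a placement of searchers on vertices of $G$ (a vertex may receive several searchers). A vertex is occupied in the layout if it contains at least one searcher, and unoccupied otherwise. A vertex is protected if it is occupied in the initial layout or if a searcher has moved there at some point, and unprotected otherwise. A vertex is fireable if the number of searchers on it is greater than or equal to the number of its unprotected neighbours. Initially every searcher is mobile; once a searcher has moved once, it becomes immobile (cannot move again). At each stage, simultaneously, for every fireable vertex $v$ containing mobile searchers, one searcher moves from $v$ to each unprotected neighbour of $v$ (excess searchers stay on $v$; several fireable vertices may send a searcher to the same target). Stages continue until no new searchers move. The layout is successful if at the end all vertices of $G$ are protected. The deduction number $d(G)$ is the minimum number of searchers in a successful layout on $G$. *)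

(* Defs.v *)
From HB Require Import structures.
From mathcomp Require Import all_boot boolp.

Set Implicit Arguments.
Unset Strict Implicit.
Unset Printing Implicit Defensive.

Record sgraph := SGraph {
  vertex :> finType;
  adj : rel vertex;
  adj_sym : symmetric adj;
  adj_irr : irreflexive adj }.

Section CartesianProduct.
Variables G H : sgraph.

Definition box_adj : rel (G * H)%type := fun x y =>
  ((x.1 == y.1) && adj x.2 y.2) || ((x.2 == y.2) && adj x.1 y.1).

Lemma box_adj_sym : symmetric box_adj.
Proof.
move=> x y.
by rewrite /box_adj (eq_sym x.1) (eq_sym x.2) (adj_sym x.1) (adj_sym x.2).
Qed.

Lemma box_adj_irr : irreflexive box_adj.
Proof. by move=> x; rewrite /box_adj !adj_irr !andbF. Qed.

Definition box : sgraph := SGraph box_adj_sym box_adj_irr.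

End CartesianProduct.

Section DeductionGame.
Variable G : sgraph.

Definition layout := G -> nat.

Definition searchers (l : layout) : nat := \sum_(v : G) l v.

Record state := State {
  mobile : G -> nat;
  immobile : G -> nat;
  protected : {set G} }.

Definition initial (l : layout) : state :=
  State l (fun=> 0) [set v | 0 < l v].

Definition unprotected_nbrs (s : state) (v : G) : {set G} :=
  [set w | adj v w & w \notin protected s].

Definition fireable (s : state) (v : G) : bool :=
  #|unprotected_nbrs s v| <= mobile s v + immobile s v.

Definition fires (s : state) (v : G) : bool := fireable s v && (0 < mobile s v).

(* The firing vertices that send a searcher to w in the next stage. *)
Definition senders (s : state) (w : G) : {set G} :=
  [set v | fires s v & w \in unprotected_nbrs s v].

Definition targets (s : state) : {set G} := [set w | senders s w != set0].

(* The truncated subtraction is harmless: in a state reached from [initial l],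
   no vertex holds both mobile and immobile searchers, since only unprotected,
   hence initially unoccupied, vertices ever receive a searcher. *)
Definition stage (s : state) : state :=
  State
    (fun v => if fires s v then mobile s v - #|unprotected_nbrs s v|
              else mobile s v)
    (fun w => immobile s w + #|senders s w|)
    (protected s :|: targets s).

Definition halted (s : state) : Prop := targets s = set0.

Definition successful (l : layout) : Prop :=
  exists n, let s := iter n stage (initial l) in
    halted s /\ protected s = [set: G].

Definition has_successful (k : nat) : bool :=
  `[< exists l : layout, successful l /\ searchers l = k >].

Lemma ex_has_successful : exists k, has_successful k.
Proof.
exists (searchers (fun=> 1)); apply/asboolP; exists (fun=> 1); split=> //.
exists 0 => /=; split; last by apply/setP=> v; rewrite !inE.
apply/setP=> w; rewrite !inE; apply/negbTE; rewrite negbK.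
by apply/eqP/setP=> v; rewrite !inE /= !andbF.
Qed.

Definition deduction_number : nat := ex_minn ex_has_successful.

End DeductionGame.

(* Main.v *)
Require Import Defs.
From mathcomp Require Import all_boot.
From mathcomp Require boolp.

Set Implicit Arguments.
Unset Strict Implicit.

(** The idea is to play an optimal game on one factor simultaneously in all of
    its copies.  Put [l v] searchers on every vertex of the product lying over
    [v], where [l] is an optimal layout of the factor.  The copies of a vertex
    are protected at the same stage, so an edge joining two copies of [v] never
    influences the game: a vertex that can fire holds a mobile searcher, hence
    was occupied initially, hence all of its copies are already protected.  The
    remaining edges reproduce the factor exactly, so by induction on the number
    of stages the game on the product is the pullback of the game on the factor
    ([lifts_iter_stage]), and it succeeds when the latter does.

    The argument uses only the local behaviour of the projection, isolated in
    [local_projection], and the common size of its fibres.  Both projections of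
    the product qualify, so the two bounds are instances of the same inequality
    [deduction_number_local_projection]. *)

(** A graph covering in which edges inside the fibres are also permitted: an
    edge at [p x] lifts uniquely to an edge at [x], and every edge that is not
    such a lift is contracted by [p]. *)
Definition local_projection (K H : sgraph) (p : K -> H) : Prop :=
  [/\ forall x y, adj x y -> p x != p y -> adj (p x) (p y),
      forall x w, adj (p x) w -> exists2 y, adj x y & p y = w
    & forall x y z, adj x y -> adj x z -> adj (p x) (p y) -> p y = p z -> y = z].

(** The invariant that makes the edges inside the fibres inert: a vertex that
    fires has its whole fibre protected. *)
Definition guarded (G : sgraph) (s : state G) : Prop :=
  forall v, 0 < mobile s v -> v \in protected s.

Definition lifts (K H : sgraph) (p : K -> H) (t : state K) (s : state H) : Prop :=
  [/\ mobile t =1 mobile s \o p, immobile t =1 immobile s \o p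
    & protected t = p @^-1: protected s].

Lemma guarded_initial (G : sgraph) (l : layout G) : guarded (initial l).
Proof. by move=> v; rewrite inE. Qed.

Lemma guarded_stage (G : sgraph) (s : state G) : guarded s -> guarded (stage s).
Proof.
move=> gs v /= mv; rewrite inE gs //; case: (fires s v) mv => // mv.
exact: leq_trans mv (leq_subr _ _).
Qed.

Lemma guarded_iter_stage (G : sgraph) (l : layout G) n :
  guarded (iter n (@stage G) (initial l)).
Proof.
elim: n => [|n IHn]; first exact: guarded_initial.
exact: guarded_stage.
Qed.

Section LocalProjection.

Variables (K H : sgraph) (p : K -> H).
Hypothesis p_local : local_projection p.

(** Unique lifting makes [p] a bijection from the neighbours of [x] over [A]
    onto [A]. *)
Lemma card_nbrs_over (x : K) (A : {set H}) :
  {subset A <= adj (p x)} -> #|[set y | adj x y & p y \in A]| = #|A|.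
Proof.
case: p_local => _ p_lift p_uniq subA.
have imA : p @: [set y | adj x y & p y \in A] = A.
  apply/setP=> w; apply/imsetP/idP => [[y] | Aw].
    by rewrite inE => /andP[_ Ay] ->.
  by have [y xy yw] := p_lift x w (subA w Aw); exists y; rewrite // inE xy yw.
rewrite -[in RHS]imA card_in_imset // => y z; rewrite !inE => /andP[xy Ay] /andP[xz _].
exact: p_uniq xy xz (subA _ Ay).
Qed.

Section Stage.

Variables (t : state K) (s : state H).
Hypotheses (gs : guarded s) (ts : lifts p t s).

(** The vertices over [p x] are all protected, so only lifted edges at [x] can
    lead to an unprotected vertex. *)
Lemma unprotected_nbrs_lift (x : K) : p x \in protected s ->
  unprotected_nbrs t x = [set y | adj x y & p y \in unprotected_nbrs s (p x)].
Proof.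
case: ts => _ _ tsP px; case: p_local => p_adj _ _.
apply/setP=> y; rewrite !inE tsP inE.
case xy: (adj x y) => //=; case py: (p y \in protected s); first by rewrite andbF.
by rewrite p_adj //; apply: contraFneq py => <-.
Qed.

Lemma card_unprotected_nbrs_lift (x : K) : p x \in protected s ->
  #|unprotected_nbrs t x| = #|unprotected_nbrs s (p x)|.
Proof.
move=> px; rewrite unprotected_nbrs_lift // card_nbrs_over // => w.
by rewrite inE => /andP[].
Qed.

Lemma fires_lift (x : K) : fires t x = fires s (p x).
Proof.
case: (ts) => tsM tsI _; rewrite /fires /fireable tsM tsI /=.
case: posnP => [_ | /gs px]; first by rewrite !andbF.
by rewrite card_unprotected_nbrs_lift.
Qed.

Lemma senders_lift (y : K) :
  senders t y = [set x | adj y x & p x \in senders s (p y)].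
Proof.
apply/setP=> x; rewrite !inE fires_lift adj_sym.
case fx: (fires s (p x)); last by rewrite andbF.
have px: p x \in protected s by apply: gs; case/andP: fx.
by have /setP/(_ y) := unprotected_nbrs_lift px; rewrite !inE (adj_sym x).
Qed.

Lemma card_senders_lift (y : K) : #|senders t y| = #|senders s (p y)|.
Proof.
rewrite senders_lift card_nbrs_over // => v; rewrite !inE => /and3P[_ vy _].
by rewrite -topredE /= adj_sym.
Qed.

Lemma targets_lift : targets t = p @^-1: targets s.
Proof. by apply/setP=> y; rewrite !inE -!cards_eq0 card_senders_lift. Qed.

Lemma lifts_stage : lifts p (stage t) (stage s).
Proof.
case: (ts) => tsM tsI tsP; split=> [x | y |] /=.
- rewrite fires_lift tsM /=; case fx: (fires s (p x)) => //.
  by rewrite card_unprotected_nbrs_lift //; apply: gs; case/andP: fx.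
- by rewrite tsI card_senders_lift.
- by rewrite tsP targets_lift preimsetU.
Qed.

End Stage.

Lemma lifts_iter_stage (l : layout H) n :
  lifts p (iter n (@stage K) (initial (l \o p))) (iter n (@stage H) (initial l)).
Proof.
elim: n => [|n IHn]; first by split=> //; apply/setP=> x; rewrite !inE.
apply: lifts_stage IHn; exact: guarded_iter_stage.
Qed.

Lemma successful_lift (l : layout H) : successful l -> successful (l \o p : layout K).
Proof.
case=> n [halt_s full_s]; exists n; have ts := lifts_iter_stage l n.
split; last by case: ts => _ _ ->; rewrite full_s preimsetT.
rewrite /halted (targets_lift (@guarded_iter_stage _ l n) ts).
by rewrite halt_s preimset0.
Qed.

Lemma searchers_lift (l : layout H) m :
  (forall v, #|p @^-1: [set v]| = m) -> searchers (l \o p : layout K) = m * searchers l.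
Proof.
move=> fibre_m; rewrite /searchers (partition_big p xpredT) //= big_distrr /=.
apply: eq_bigr => v _; rewrite (eq_bigr (fun=> l v)) => [|x /eqP-> //].
rewrite sum_nat_const -(fibre_m v); congr (_ * _).
by apply: eq_card => x; rewrite !inE.
Qed.

End LocalProjection.

Lemma deduction_number_le (G : sgraph) (l : layout G) :
  successful l -> deduction_number G <= searchers l.
Proof.
move=> win; rewrite /deduction_number; case: ex_minnP => k _; apply.
by apply/boolp.asboolP; exists l.
Qed.

Lemma deduction_number_witness (G : sgraph) :
  exists2 l : layout G, successful l & searchers l = deduction_number G.
Proof.
rewrite /deduction_number; case: ex_minnP => k /boolp.asboolP[l [win lk]] _.
by exists l.
Qed.

Lemma deduction_number_local_projection (K H : sgraph) (p : K -> H) m :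
  local_projection p -> (forall v, #|p @^-1: [set v]| = m) ->
  deduction_number K <= m * deduction_number H.
Proof.
move=> p_local fibre_m; have [l win <-] := deduction_number_witness H.
rewrite -(searchers_lift l fibre_m).
exact: deduction_number_le (successful_lift p_local win).
Qed.

Lemma local_projection_snd (G H : sgraph) :
  local_projection (snd : box G H -> H).
Proof.
split=> [[g v] [g' v'] | [g v] w /= vw | [g v] [g1 v1] [g2 v2]] /=.
- by case/orP=> /andP[] //= /eqP->; rewrite eqxx.
- by exists (g, w); rewrite // /box_adj /= eqxx vw.
- rewrite /box_adj /= => e1 e2 vv1 eqv; rewrite -eqv vv1 in e2 *.
  (* an edge that changes the second coordinate keeps the first one *)
  have neq: (v == v1) = false by apply: contraTF vv1 => /eqP->; rewrite adj_irr.
  move: e1 e2; rewrite vv1 neq !andbT !orbF.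
  by move=> /eqP<- /eqP<-.
Qed.

Lemma local_projection_fst (G H : sgraph) :
  local_projection (fst : box G H -> G).
Proof.
split=> [[g v] [g' v'] | [g v] w /= gw | [g v] [g1 v1] [g2 v2]] /=.
- by case/orP=> /andP[] //= /eqP->; rewrite eqxx.
- by exists (w, v); rewrite // /box_adj /= eqxx gw orbT.
- rewrite /box_adj /= => e1 e2 gg1 eqg; rewrite -eqg gg1 in e2 *.
  have neq: (g == g1) = false by apply: contraTF gg1 => /eqP->; rewrite adj_irr.
  move: e1 e2; rewrite gg1 neq !andbT /=.
  by move=> /eqP<- /eqP<-.
Qed.

Lemma card_fibre_snd (G H : finType) (v : H) :
  #|(snd : G * H -> H) @^-1: [set v]| = #|G|.
Proof.
rewrite -[RHS]muln1 -cardsT -(cards1 v) -cardsX.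
by apply: eq_card => x; rewrite !inE.
Qed.

Lemma card_fibre_fst (G H : finType) (g : G) :
  #|(fst : G * H -> G) @^-1: [set g]| = #|H|.
Proof.
rewrite -[RHS]mul1n -cardsT -(cards1 g) -cardsX.
by apply: eq_card => x; rewrite !inE andbT.
Qed.

Unset Implicit Arguments.
Set Strict Implicit.

Theorem theorem4p9 (G H : sgraph) :
  deduction_number (box G H)
    <= minn (#|G| * deduction_number H) (#|H| * deduction_number G).
Proof.
rewrite leq_min; apply/andP; split.
- apply: deduction_number_local_projection (local_projection_snd G H) _.
  exact: card_fibre_snd.
- apply: deduction_number_local_projection (local_projection_fst G H) _.
  exact: card_fibre_fst.
Qed.
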